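(* For each integer $d$ with $1\le d<\omega$, there is a Boolean algebra of size $\aleph_d$ that has the $d$-ary FN but does not have the $(d+1)$-ary FN.
   Context: For Boolean algebras $A\le B$ (subalgebra), $A$ is relatively complete in $B$, written $A\le_{\mathrm{rc}}B$, if for every $y\in B$ the set $\{x\in A: x\le y\}$ has a maximum. For a subset $S$ of a Boolean algebra, $\langle S\rangle$ denotes the subalgebra generated by $S$. A family $\mathcal{C}$ of countable subsets of a set $S$ is a club if it is cofinal in $([S]^{<\aleph_1},\subseteq)$ and closed under unions of countable nonempty chains. For $d\le\omega$, a Boolean algebra $A$ has the $d$-ary FN if there is a club $\mathcal{E}\subseteq[A]^{<\aleph_1}$ such that $B\le_{\mathrm{rc}}A$ for every subalgebra $B$ of $A$ generated by a union of fewer than $d$ elements of $\mathcal{E}$. *)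

(* Defs.v *)
From HB Require Import structures.
From mathcomp Require Import all_boot all_order.
From mathcomp Require Import boolp classical_sets functions cardinality.

Set Implicit Arguments.
Unset Strict Implicit.
Unset Printing Implicit Defensive.

Local Open Scope classical_set_scope.
Local Open Scope card_scope.

(* |A| = aleph_n.  In the successor case |A| is the least cardinal above
   |B| = aleph_n: it exceeds |B|, and every cardinal below |A| (that is, the
   cardinal of a subset C of A with |C| < |A|) is at most |B|. *)
Fixpoint card_aleph (T : Type) (n : nat) (A : set T) : Prop :=
  match n with
  | 0 => A #= [set: nat]
  | m.+1 => exists B : set T,
      [/\ B `<=` A, card_aleph m B, ~ (A #<= B)
        & forall C : set T, C `<=` A -> ~ (A #<= C) -> C #<= B]
  end.

Definition countable_subsets (T : Type) (S : set T) : set (set T) :=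
  [set X | X `<=` S /\ countable X].

Definition club (T : Type) (S : set T) (C : set (set T)) : Prop :=
  [/\ C `<=` countable_subsets S,
      forall X, countable_subsets S X -> exists2 Y, C Y & X `<=` Y
    & forall K : set (set T), K `<=` C -> countable K -> K !=set0 ->
        total_on K subset -> C (\bigcup_(X in K) X)].

Section BooleanAlgebra.
Context {disp : Order.disp_t} {A : ctbDistrLatticeType disp}.
Implicit Types (B D S : set A).

Definition subalgebra B : Prop :=
  [/\ B (\bot)%O, B (\top)%O,
      forall x y, B x -> B y -> B (Order.meet x y),
      forall x y, B x -> B y -> B (Order.join x y)
    & forall x, B x -> B (Order.compl x)].

Definition generated S : set A := smallest subalgebra S.

Definition relatively_complete B D : Prop :=
  [/\ subalgebra B, subalgebra D, B `<=` D
    & forall y, D y ->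
        let below := [set x | B x /\ (x <= y)%O] in
        exists m, below m /\ ubound below m].

End BooleanAlgebra.

(* The d-ary FN for finite d.  The union of the empty subfamily of E is
   allowed (it generates the two-element subalgebra). *)
Definition ary_FN (disp : Order.disp_t) (A : ctbDistrLatticeType disp)
    (d : nat) : Prop :=
  exists E : set (set A), club [set: A] E /\
    forall (k : nat) (F : set (set A)),
      (k < d)%N -> F #= `I_k -> F `<=` E ->
      relatively_complete (generated (\bigcup_(X in F) X)) [set: A].

(* Main.v *)
(* Take the product of d copies of aleph_d.  The algebra has generators y_s, one
   for each d-tuple s, and x_{t,n} (n < omega), for each facet t of a tuple (a
   tuple with one coordinate erased), subject to the relations
     x_{t_1,n} /\ ... /\ x_{t_d,n} <= y_s      (t_1, ..., t_d the facets of s).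
   For I countable, let A_I be generated by the generators with coordinates in
   I.  If fewer than d of these contain all facets of s, then one contains two of
   them and hence y_s; so a union of fewer than d of them never captures all
   facets of a tuple without the tuple itself, and then it generates a relatively
   complete subalgebra.  Conversely, given any club E, choose the coordinates of s
   from the last one down (as in Kuratowski's free set theorem) so that the member
   N_i of E chosen to contain the x_{t_i,n} does not involve y_s.  The subalgebra
   generated by N_1, ..., N_d contains the lower bounds x_{t_1,n} /\ ... /\ x_{t_d,n}
   of y_s for all n, and none of its elements below y_s is above all of these,
   because such an element depends on finitely many generators other than y_s. *)

From HB Require Import structures.
Require Import Defs.
From mathcomp Require Import all_boot all_order.
From mathcomp Require Import boolp classical_sets functions cardinality wochoice.

Set Implicit Arguments.
Unset Strict Implicit.
Unset Printing Implicit Defensive.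

Local Open Scope classical_set_scope.
Local Open Scope card_scope.

(** * Cardinal comparison by injections, and well-orders *)

Definition embeds (A B : Type) : Prop := exists f : A -> B, injective f.

Lemma embeds_refl A : embeds A A.
Proof. by exists id. Qed.

Lemma embeds_trans B A C : embeds A B -> embeds B C -> embeds A C.
Proof. by move=> [f fi] [g gi]; exists (g \o f); exact: inj_comp. Qed.

Lemma embeds_prod A B A' B' :
  embeds A A' -> embeds B B' -> embeds (A * B) (A' * B').
Proof.
move=> [f fi] [g gi]; exists (fun p => (f p.1, g p.2)).
by move=> [a b] [a' b'] /= [/fi -> /gi ->].
Qed.

Lemma embeds_sub A (P Q : A -> Prop) :
  (forall a, P a -> Q a) -> embeds {a | P a} {a | Q a}.
Proof.
move=> PQ; exists (fun a => exist Q (sval a) (PQ _ (svalP a))).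
by move=> [a ha] [b hb] [] /= ab; exact/eq_exist.
Qed.

Lemma embeds_sig A (P : A -> Prop) : embeds {a | P a} A.
Proof. by exists sval => -[a ha] [b hb] /= ab; exact/eq_exist. Qed.

Lemma embeds_card_le T U (A : set T) (B : set U) : embeds A B <-> (A #<= B).
Proof.
split=> [[f fi]|/card_leP[f]].
  apply/card_leP/injfunPex; exists f => //.
  by move=> x y _ _; exact: fi.
exists f => x y; apply: inj; exact: in_setT.
Qed.

Lemma embeds_setT T U : embeds T U <-> ([set: T] #<= [set: U]).
Proof.
rewrite -embeds_card_le; split=> -[f fi].
  exists (fun x => SigSub (in_setT (f (val x)))).
  by move=> x y /(congr1 val) /= /fi /val_inj.
exists (fun x => val (f (SigSub (in_setT x)))).
by move=> x y /val_inj /fi /(congr1 val).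
Qed.

(* Transfinite recursion: send [w] to a point of [T] outside the image of the
   predecessors of [w], which has at most [B] points. *)
Lemma embeds_segments (W T B : Type) (R : W -> W -> Prop) :
  well_founded R -> (forall x y, x <> y -> R x y \/ R y x) ->
  (forall w, embeds {v | R v w} B) -> ~ embeds T B -> embeds W T.
Proof.
move=> wfR triR segR nTB.
have fresh w (r : forall v, R v w -> T) : exists t, forall v h, r v h <> t.
  apply: contrapT => nex; apply: nTB.
  have pre t : {v : {v | R v w} | r (sval v) (svalP v) = t}.
    apply: cid; apply: contrapT => nt; apply: nex; exists t => v h rt.
    by apply: nt; exists (exist _ v h); rewrite -rt /=; congr (r v); exact: Prop_irrelevance.
  apply: embeds_trans (segR w); exists (fun t => sval (pre t)).
  by move=> t t' e; rewrite -(svalP (pre t)) -(svalP (pre t')) e.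
pose f := Fix wfR (fun=> T) (fun w r => sval (cid (fresh w r))).
have fE w : f w = sval (cid (fresh w (fun v _ => f v))).
  rewrite /f Fix_eq // => x g g' gg'; have -> // : g = g'.
  by apply: functional_extensionality_dep => v; apply/funext => h; exact: gg'.
have fR v w : R v w -> f v <> f w.
  by move=> vw; rewrite [f w]fE; case: cid => t /= /(_ v vw).
exists f => v w vw; apply: contrapT => /triR[/fR|/fR]; first by [].
by move=> /(_ (esym vw)).
Qed.

(** The strict part of a relation for which every nonempty set has a least element. A least
    inaccessible point would be accessible; transitivity comes from the least of the three
    points. *)
Lemma well_order_type (T : Type) : exists lt : T -> T -> Prop,
  [/\ well_founded lt, forall x y z, lt x y -> lt y z -> lt x z
    & forall x y, x <> y -> lt x y \/ lt y x].
Proof.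
have [R woR] := well_ordering_principle {classic T}.
have woR' : wo_chain R predT by move=> A _; exact: woR.
have tot x y : R x y || R y x by exact: (wo_chainW woR').
have refl x : R x x by exact: (wo_chain_reflexive woR').
have anti x y : R x y -> R y x -> x = y.
  by move=> xy yx; apply: (wo_chain_antisymmetric woR') => //; apply/andP.
have minP (P : T -> Prop) x : P x -> exists2 z, P z & forall y, P y -> R z y.
  move=> Px; have [|z [[zP zlb] _]] := woR [pred x | `[< P x >]].
    by exists x; exact/asboolP.
  exists z; first exact/asboolP.
  by move=> y Py; apply: zlb; exact/asboolP.
exists (fun x y => R x y /\ x <> y); split.
- move=> x; apply: contrapT => /(minP (fun x => ~ Acc _ x))[z nz zmin].
  apply: nz; constructor => y [yz ne]; apply: contrapT => /zmin zy.
  by apply: ne; exact: anti.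
- move=> x y z [xy nxy] [yz nyz].
  have [u uP umin] := minP (fun u => [\/ u = x, u = y | u = z]) x (Or31 _ _ erefl).
  have [ux uy uz] : [/\ R u x, R u y & R u z].
    by split; apply: umin; [exact: Or31|exact: Or32|exact: Or33].
  case: uP => uE; subst u.
  + by split=> // xz; subst z; apply: nxy; exact: anti.
  + by case: nxy; exact: anti.
  + by case: nyz; exact: anti.
- move=> x y ne; have /orP[xy|yx] := tot x y; [left|right]; split=> //.
  by move=> /esym.
Qed.

(** Recursion along a well-order of [B] itself, whose segments embed in [B] trivially. *)
Lemma not_embeds T B : ~ embeds T B -> embeds B T.
Proof.
have [lt [wf _ tri]] := well_order_type B.
by apply: (embeds_segments wf tri) => w; exact: embeds_sig.
Qed.

(** * Successor cardinals and the alephs *)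

(** The order bounds [T] from above: by [embeds_segments], [T] embeds in every type that does not
    embed in [B]. *)
Definition successor (B T : Type) : Prop :=
  ~ embeds T B /\ exists lt : T -> T -> Prop,
  [/\ well_founded lt, forall x y z, lt x y -> lt y z -> lt x z,
      forall x y, x <> y -> lt x y \/ lt y x
    & forall t, embeds {s | lt s t} B].

(** In a well-order of the power set of [B], keep the points up to which all segments embed in [B].
    If some point is dropped, the kept ones include all points below the first [w] whose segment
    does not embed, so together they do not embed either. *)
Lemma successor_exists (B : Type) : exists T : Type, successor B T.
Proof.
have [lt [wf tr tri]] := well_order_type (B -> Prop).
pose small u := embeds {v | lt v u} B.
pose P u := forall v, lt v u \/ v = u -> small v.
have [allP|nall] := pselect (forall u, P u).
  exists (B -> Prop); split; last first.
    by exists lt; split=> // t; apply: (allP t); right.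
  (* Cantor's diagonal: [D] collects the codes [f S] lying outside the predicate [S] that they
     code. *)
  move=> [f fi]; pose D b := exists S, f S = b /\ ~ S b.
  have [Df|Df] := pselect (D (f D)); last by apply: (Df); exists D.
  by move: (Df) => [S [/fi ->]].
have {nall}[u nPu] : exists u, ~ P u.
  apply: contrapT => h; apply: nall => u.
  by apply: contrapT => nu; apply: h; exists u.
have {nPu}[u0 nu0] : exists u, ~ small u.
  apply: contrapT => h; apply: nPu => v _; apply: contrapT => nv.
  by apply: h; exists v.
have {nu0}[w [nu umin]] : exists u, ~ small u /\ forall v, lt v u -> small v.
  elim/(well_founded_ind wf): u0 nu0 => w IH nu.
    have [h|h] := pselect (forall v, lt v w -> small v); first by exists w.
    apply: contrapT => nex; apply: h => v vw; apply: contrapT => nv.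
    by apply: nex; exact: IH nv.
exists {v | P v}; split.
  move=> h; apply: nu; apply: embeds_trans h; apply: embeds_sub => v vw x.
  by move=> [xv|->]; apply: umin => //; exact: tr vw.
exists (fun a b => lt (sval a) (sval b)); split.
- move=> [a Pa]; elim/(well_founded_ind wf): a Pa => a IH Pa.
  by constructor=> -[b Pb] /= ba; exact: IH.
- by move=> a b c; exact: tr.
- by move=> [a Pa] [b Pb] ab; apply: tri => /= e; apply: ab; exact/eq_exist.
- move=> [t Pt]; apply: embeds_trans (Pt t (or_intror erefl)).
  exists (fun a => exist (fun v => lt v t) (sval (sval a)) (svalP a)).
  by move=> [[a ?] ?] [[b ?] ?] /= [ab]; do 2! [apply: eq_exist => //=].
Qed.

Fixpoint aleph (n : nat) : Type :=
  if n is m.+1 then sval (cid (successor_exists (aleph m))) else nat.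

Lemma alephS n : successor (aleph n) (aleph n.+1).
Proof. by rewrite /=; case: cid. Qed.

Lemma aleph_lt n : ~ embeds (aleph n.+1) (aleph n).
Proof. by have [] := alephS n. Qed.

Lemma aleph_le m n : (m <= n)%N -> embeds (aleph m) (aleph n).
Proof.
elim: n => [|n IH]; first by rewrite leqn0 => /eqP ->; exact: embeds_refl.
rewrite leq_eqVlt => /orP[/eqP ->|/IH mn]; first exact: embeds_refl.
by apply: embeds_trans mn (not_embeds _); exact: aleph_lt.
Qed.

(** The subset required at the previous level is the image of [aleph n] in [A]. A subset that does
    not embed in [aleph n] contains a copy of [aleph n.+1], hence of [A], because the segments of
    [aleph n.+1] embed in [aleph n]. *)
Lemma card_aleph_aleph n T (A : set T) : A #= [set: aleph n] -> card_aleph n A.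
Proof.
elim: n T A => [|n IH] T A AE //.
have An : embeds A (aleph n.+1) /\ embeds (aleph n.+1) A.
  move: AE; rewrite card_eq_le => /andP[/embeds_card_le h1 /embeds_card_le h2].
  have e1 : embeds (aleph n.+1) [set: aleph n.+1].
    by exists (fun x => SigSub (in_setT x)) => x y /(congr1 val).
  have e2 : embeds [set: aleph n.+1] (aleph n.+1).
    by exists val; exact: val_inj.
  by split; [exact: embeds_trans e2|exact: embeds_trans h2].
have [f fi] := An.2; have [g gi] := aleph_le (leqnSn n).
pose h x := val (f (g x)).
have hi : injective h by move=> x y /val_inj/fi/gi.
have hB : range h #= [set: aleph n].
  by apply: inj_card_eq => x y _ _; exact: hi.
have Bn C : C `<=` A -> (embeds C (aleph n)) <-> (C #<= range h).
  move=> CA; rewrite (card_le_eqr hB) -embeds_card_le; split=> e.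
    apply: embeds_trans e _.
    by exists (fun x => SigSub (in_setT x)) => x y /(congr1 val).
  by apply: embeds_trans e _; exists val; exact: val_inj.
exists (range h); split.
- by move=> _ [x _ <-]; rewrite /h; apply: set_valP.
- exact: IH.
- by move=> /(Bn A (@subset_refl _ _)) /(embeds_trans An.2); exact: aleph_lt.
- move=> C CA nAC; apply/(Bn C CA); apply: contrapT => nC; apply: nAC.
  apply/embeds_card_le; apply: embeds_trans An.1 _.
  have [_ [lt [wf _ tri seg]]] := alephS n.
  exact: embeds_segments wf tri seg nC.
Qed.

(** * Squares of alephs, and codes for finite data *)

Lemma embeds_option_square B :
  embeds nat B -> embeds (B * B) B -> embeds (option B * option B) B.
Proof.
move=> [t ti] [p pi].
pose c (o : option B) := if o is Some b then p (t 1%N, b) else p (t 0%N, t 0%N).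
have ci : injective c.
  by move=> [x|] [y|] //= /pi [] //; [move=> -> | move=> /ti | move=> /ti].
exists (fun o => p (c o.1, c o.2)).
by move=> [a b] [a' b'] /pi [] /ci -> /ci ->.
Qed.

(* Pairs are well-ordered first by their maximum, so that the predecessors of
   a pair [p] are pairs of points at most the maximum of [p]. *)
Lemma successor_square B T : embeds nat B -> embeds (B * B) B ->
  successor B T -> embeds (T * T) T.
Proof.
move=> natB BB [nTB [lt [wf tr tri seg]]].
pose le x y := lt x y \/ x = y.
have mxP (p : T * T) : exists m, le p.1 m /\ le p.2 m.
  have [e|/tri[h|h]] := pselect (p.1 = p.2).
  - by exists p.1; split; right.
  - by exists p.2; split; [left|right].
  - by exists p.1; split; [right|left].
pose mx p := sval (cid (mxP p)).
have mx1 p : le p.1 (mx p) by have [] := svalP (cid (mxP p)).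
have mx2 p : le p.2 (mx p) by have [] := svalP (cid (mxP p)).
pose R p q := lt (mx p) (mx q) \/ mx p = mx q /\
  (lt p.1 q.1 \/ p.1 = q.1 /\ lt p.2 q.2).
apply: (embeds_segments (R := R) (B := B)) nTB.
(* Three nested inductions: on the maximum, then on the first and on the second coordinate. *)
- suff acc m : forall a b p, mx p = m -> p.1 = a -> p.2 = b -> Acc R p.
    by move=> p; exact: (acc _ _ _ p erefl erefl erefl).
  elim/(well_founded_ind wf): m => m IHm a.
  elim/(well_founded_ind wf): a => a IHa b.
  elim/(well_founded_ind wf): b => b IHb p pm pa pb.
  constructor => q [qm|[qm [qa|[qa qb]]]].
  + by apply: (IHm (mx q)) => //; rewrite -pm.
  + by apply: (IHa q.1) => //; [rewrite -pa|rewrite qm].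
  + by apply: (IHb q.2) => //; [rewrite -pb|rewrite qm|rewrite qa].
- move=> p q pq.
  have [em|/tri[h|h]] := pselect (mx p = mx q); [|by left; left|by right; left].
  have [e1|/tri[h|h]] := pselect (p.1 = q.1); [|by left; right; split=> //; left
    |by right; right; split=> //; left].
  have [e2|/tri[h|h]] := pselect (p.2 = q.2); [|by left; right; split=> //; right
    |by right; right; split=> //; right].
  by case: pq; case: p q e1 e2 {em} => [? ?] [? ?] /= -> ->.
- move=> q; apply: embeds_trans (embeds_option_square natB BB).
  have [f fi] := seg (mx q).
  (* Points below the maximum go to [Some], the maximum itself to [None]. *)
  pose c x := if pselect (lt x (mx q)) is left h then Some (f (exist _ x h)) else None.
  have ci x y : le x (mx q) -> le y (mx q) -> c x = c y -> x = y.
    rewrite /c /le; case: pselect => [hx|nx]; case: pselect => [hy|ny] //.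
      by move=> _ _ [/fi []].
    by move=> [//|->] [//|->].
  have Rle p : R p q -> le p.1 (mx q) /\ le p.2 (mx q).
    have le_lt x y : le x (mx y) -> lt (mx y) (mx q) -> le x (mx q).
      by move=> [xy yq|->]; left => //; exact: tr yq.
    move=> [pq|[<- _]]; last by [].
    by split; apply: le_lt pq.
  exists (fun p => (c (sval p).1, c (sval p).2)).
  move=> [[a b] /= hp] [[a' b'] /= hp'] [].
  have [/= la lb] := Rle _ hp; have [/= la' lb'] := Rle _ hp'.
  by move=> /(ci _ _ la la') ea /(ci _ _ lb lb') eb; apply: eq_exist; rewrite ea eb.
Qed.

Lemma embeds_nat_aleph n : embeds nat (aleph n).
Proof. exact: (@aleph_le 0). Qed.

Lemma aleph_square n : embeds (aleph n * aleph n) (aleph n).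
Proof.
elim: n => [|n IH]; first by exists choice.pickle; exact: pcan_inj choice.pickleK.
exact: successor_square (embeds_nat_aleph n) IH (alephS n).
Qed.

Section Coding.
Context {T : Type} (natT : embeds nat T) (TT : embeds (T * T) T).

Lemma embeds_prod_in A B : embeds A T -> embeds B T -> embeds (A * B) T.
Proof. by move=> AT BT; apply: embeds_trans TT; exact: embeds_prod. Qed.

Lemma embeds_seq_in A : embeds A T -> embeds (seq A) T.
Proof.
move=> [f fi]; have [t ti] := natT; have [p pi] := TT.
pose c := fix c l := if l is a :: l' then p (t 1%N, p (f a, c l')) else p (t 0%N, t 0%N).
exists c; elim=> [|a l IH] [|b l'] //= /pi []; [by move=> /ti|by move=> /ti|].
by move=> /pi [/fi -> /IH ->].
Qed.

Lemma embeds_sum_in A B : embeds A T -> embeds B T -> embeds (A + B) T.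
Proof.
move=> [f fi] [g gi]; have [t ti] := natT; have [p pi] := TT.
exists (fun x => match x with inl a => p (t 0%N, f a) | inr b => p (t 1%N, g b) end).
by move=> [a|b] [a'|b'] /pi []; [move=> /fi ->|move=> /ti|move=> /ti|move=> /gi ->].
Qed.

Lemma embeds_tuple_in n A : embeds A T -> embeds ('I_n -> A) T.
Proof.
move=> AT; apply: embeds_trans (embeds_seq_in AT).
exists (fun s => [seq s i | i <- enum 'I_n]) => s s' /eq_in_map ss'.
by apply/funext => i; apply: ss'; rewrite mem_enum.
Qed.

End Coding.

(** * Propositional formulas *)

(** Formulas name clopen sets: counting them bounds cardinals, and [vars] gives finite supports. *)
Inductive form (V : Type) : Type :=
| Bot
| Var of V
| And of form V & form V
| Neg of form V.
Arguments Bot {V}.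

Definition Or V (f g : form V) := Neg (And (Neg f) (Neg g)).

Fixpoint sat V (p : V -> bool) (f : form V) : bool :=
  match f with
  | Bot => false
  | Var v => p v
  | And g h => sat p g && sat p h
  | Neg g => ~~ sat p g
  end.

Fixpoint vars V (f : form V) : seq V :=
  match f with
  | Bot => [::]
  | Var v => [:: v]
  | And g h => vars g ++ vars h
  | Neg g => vars g
  end.

Lemma sat_Or V (p : V -> bool) f g : sat p (Or f g) = sat p f || sat p g.
Proof. by rewrite /= -negb_or negbK. Qed.

Fixpoint form_map V W (e : V -> W) (f : form V) : form W :=
  match f with
  | Bot => Bot
  | Var v => Var (e v)
  | And g h => And (form_map e g) (form_map e h)
  | Neg g => Neg (form_map e g)
  end.

Lemma embeds_form_in T V : embeds nat T -> embeds (T * T) T -> embeds V T ->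
  embeds (form V) T.
Proof.
move=> [t ti] [p pi] [e ei].
pose c := fix c f := match f with
  | Bot => p (t 0%N, t 0%N)
  | Var v => p (t 1%N, e v)
  | And g h => p (t 2%N, p (c g, c h))
  | Neg g => p (t 3%N, c g)
  end.
exists c; elim=> [|v|g IHg h IHh|g IHg] [|v'|g' h'|g'] //= /pi [];
  try by move=> /ti.
- by move=> /ei ->.
- by move=> /pi [/IHg -> /IHh ->].
- by move=> /IHg ->.
Qed.

Section FormChoice.
Context {V : choiceType}.
Implicit Types (p q : V -> bool) (f g : form V).

Lemma sat_eq_in p q f : {in vars f, p =1 q} -> sat p f = sat q f.
Proof.
elim: f => [|v|g IHg h IHh|g IHg] //= pq.
- by apply: pq; rewrite mem_head.
- by rewrite IHg ?IHh // => v vf; apply: pq; rewrite mem_cat vf ?orbT.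
- by rewrite IHg.
Qed.

Lemma form_map_inj_in W (e : V -> W) (G : set V) f g :
  {in G &, injective e} -> {subset vars f <= G} -> {subset vars g <= G} ->
  form_map e f = form_map e g -> f = g.
Proof.
move=> ei; have sub (s1 s2 : seq V) : {subset s1 ++ s2 <= G} ->
    {subset s1 <= G} /\ {subset s2 <= G}.
  by move=> h; split=> v vs; apply: h; rewrite mem_cat vs ?orbT.
elim: f g => [|v|f IHf f' IHf'|f IHf] [|w|g g'|g] //=.
- by move=> vG wG [] /ei -> //; [apply: vG|apply: wG]; rewrite mem_head.
- by move=> /sub[fG fG'] /sub[gG gG'] [/IHf -> // /IHf' ->].
- by move=> fG gG [/IHf ->].
Qed.

Definition upd p (v : V) (b : bool) : V -> bool :=
  fun w => if w == v then b else p w.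

(** Shannon expansion along the list: the two ways of fixing the head variable depend only on the
    tail. *)
Lemma form_of_dependence (P : (V -> bool) -> bool) (l : seq V) :
  (forall p q, {in l, p =1 q} -> P p = P q) ->
  exists2 f, {subset vars f <= l} & forall p, sat p f = P p.
Proof.
elim: l P => [|v l IH] P Pl.
  exists (if P (fun=> false) then Neg Bot else Bot) => [|p].
    by case: (P _).
  by rewrite (Pl p (fun=> false)) //; case: (P _).
have PE p b : p v = b -> P (upd p v b) = P p.
  by move=> pv; apply: Pl => w _; rewrite /upd; case: eqP => // ->.
have updl b p q : {in l, p =1 q} -> P (upd p v b) = P (upd q v b).
  move=> pq; apply: Pl => w; rewrite inE /upd; case: eqP => //= _; exact: pq.
have [f1 f1l f1P] := IH _ (updl true).
have [f0 f0l f0P] := IH _ (updl false).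
exists (Or (And (Var v) f1) (And (Neg (Var v)) f0)) => [w|p].
  rewrite /= inE mem_cat inE => /orP[/eqP ->|]; first by rewrite inE eqxx.
  by rewrite !inE => /orP[/f1l ->|/orP[->//|/f0l ->]]; rewrite orbT.
rewrite sat_Or /= f1P f0P; case: (boolP (p v)) => /= pv.
  by rewrite orbF PE.
by rewrite PE //; exact/negbTE.
Qed.

End FormChoice.

(** * The Boolean algebra of clopen sets *)

Fact clopen_display : Order.disp_t. Proof. exact: (Order.Disp tt tt). Qed.

Section Clopen.
Context {V : choiceType} {X : set (V -> bool)}.

Definition space_point := {p : V -> bool | X p}.

(* The Boolean algebra of clopen subsets of the subspace [X] of the Cantor
   cube [V -> bool]. *)
Record clopen := Clopen {
  clopen_fun :> space_point -> bool;
  clopen_form : exists f : form V, forall p, clopen_fun p = sat (sval p) f }.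

Lemma clopen_eq (a b : clopen) : a =1 b -> a = b.
Proof.
case: a b => [a ha] [b hb] /= /funext ab.
by move: ha hb; rewrite ab => ha hb; congr Clopen; exact: Prop_irrelevance.
Qed.

Definition of_form f : clopen :=
  @Clopen (fun p => sat (sval p) f) (ex_intro _ f (fun=> erefl)).

Lemma of_formE (a : clopen) : exists f, a = of_form f.
Proof. by have [f af] := clopen_form a; exists f; exact: clopen_eq. Qed.

Fact clopen_meet_form (a b : clopen) :
  exists f : form V, forall p, a p && b p = sat (sval p) f.
Proof.
have [[f af] [g bg]] := (clopen_form a, clopen_form b).
by exists (And f g) => p; rewrite af bg.
Qed.

Fact clopen_join_form (a b : clopen) :
  exists f : form V, forall p, a p || b p = sat (sval p) f.
Proof.
have [[f af] [g bg]] := (clopen_form a, clopen_form b).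
by exists (Or f g) => p; rewrite sat_Or af bg.
Qed.

Fact clopen_compl_form (a : clopen) :
  exists f : form V, forall p, ~~ a p = sat (sval p) f.
Proof. by have [f af] := clopen_form a; exists (Neg f) => p; rewrite af. Qed.

Definition clopen_meet a b := Clopen (clopen_meet_form a b).
Definition clopen_join a b := Clopen (clopen_join_form a b).
Definition clopen_compl a := Clopen (clopen_compl_form a).

HB.instance Definition _ := gen_eqMixin clopen.
HB.instance Definition _ := gen_choiceMixin clopen.

Fact clopen_meetC : commutative clopen_meet.
Proof. by move=> a b; apply: clopen_eq => p /=; rewrite andbC. Qed.
Fact clopen_joinC : commutative clopen_join.
Proof. by move=> a b; apply: clopen_eq => p /=; rewrite orbC. Qed.
Fact clopen_meetA : associative clopen_meet.
Proof. by move=> a b c; apply: clopen_eq => p /=; rewrite andbA. Qed.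
Fact clopen_joinA : associative clopen_join.
Proof. by move=> a b c; apply: clopen_eq => p /=; rewrite orbA. Qed.
Fact clopen_joinKI b a : clopen_meet a (clopen_join a b) = a.
Proof. by apply: clopen_eq => p /=; case: (a p). Qed.
Fact clopen_meetKU b a : clopen_join a (clopen_meet a b) = a.
Proof. by apply: clopen_eq => p /=; case: (a p). Qed.
Fact clopen_meetUl : left_distributive clopen_meet clopen_join.
Proof. by move=> a b c; apply: clopen_eq => p /=; rewrite andb_orl. Qed.
Fact clopen_meetxx : idempotent_op clopen_meet.
Proof. by move=> a; apply: clopen_eq => p /=; rewrite andbb. Qed.

HB.instance Definition _ :=
  Order.isMeetJoinDistrLattice.Build clopen_display clopen
    (fun _ _ => erefl) (fun _ _ => erefl) clopen_meetC clopen_joinC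
    clopen_meetA clopen_joinA clopen_joinKI clopen_meetKU clopen_meetUl
    clopen_meetxx.

Lemma clopen_leP (a b : clopen) : reflect (forall p, a p -> b p) (a <= b)%O.
Proof.
apply: (iffP eqP) => [ab p ap|ab]; first by move: ap; rewrite -ab => /andP[].
by apply: clopen_eq => p /=; case: (boolP (a p)) => //= /ab.
Qed.

Fact clopen_le0 a : (of_form Bot <= a)%O.
Proof. exact/clopen_leP. Qed.
Fact clopen_le1 a : (a <= of_form (Neg Bot))%O.
Proof. exact/clopen_leP. Qed.

HB.instance Definition _ :=
  Order.hasBottom.Build clopen_display clopen clopen_le0.
HB.instance Definition _ :=
  Order.hasTop.Build clopen_display clopen clopen_le1.

Fact clopen_joinxC (a : clopen) : Order.join a (clopen_compl a) = (\top)%O.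
Proof. by apply: clopen_eq => p /=; exact: orbN. Qed.
Fact clopen_meetxC (a : clopen) : Order.meet a (clopen_compl a) = (\bot)%O.
Proof. by apply: clopen_eq => p /=; exact: andbN. Qed.

HB.instance Definition _ := Order.TBDistrLattice_hasComplement.Build
  clopen_display clopen clopen_joinxC clopen_meetxC.

Lemma clopen_meetE (a b : clopen) p : Order.meet a b p = a p && b p.
Proof. by []. Qed.
Lemma clopen_joinE (a b : clopen) p : Order.join a b p = a p || b p.
Proof. by []. Qed.

(** The two complement laws, evaluated at [p], determine the value. *)
Lemma clopen_complE (a : clopen) p : Order.compl a p = ~~ a p.
Proof.
have := congr1 (fun c : clopen => c p) (Order.CTBDistrLatticeTheory.joinxC a).
have := congr1 (fun c : clopen => c p) (Order.CTBDistrLatticeTheory.meetxC a).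
rewrite clopen_meetE clopen_joinE; change ((\bot%O : clopen) p) with false.
by change ((\top%O : clopen) p) with true; case: (a p); case: (Order.compl a p).
Qed.

End Clopen.
Arguments space_point {V} X.
Arguments clopen {V} X.
Arguments of_form {V X} f.

(** * Subalgebras generated by sets of variables *)

Section Over.
Context {V : choiceType} {X : set (V -> bool)}.
Implicit Types (G H : set V) (a b : clopen X) (p q : V -> bool).

Definition clopen_over G : set (clopen X) :=
  [set a | exists2 f, {subset vars f <= G} & a = of_form f].

Lemma over_subset G H : G `<=` H -> clopen_over G `<=` clopen_over H.
Proof.
by move=> GH a [f fG ->]; exists f => // v /fG; rewrite !inE; exact: GH.
Qed.

Lemma over_var G v : G v -> clopen_over G (of_form (Var v)).
Proof. by move=> Gv; exists (Var v) => // w; rewrite !inE => /eqP ->. Qed.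

Lemma of_form_And f g : of_form (And f g) = Order.meet (of_form f) (of_form g) :> clopen X.
Proof. exact: clopen_eq. Qed.

Lemma of_form_Neg f : of_form (Neg f) = Order.compl (of_form f) :> clopen X.
Proof. by apply: clopen_eq => p; rewrite clopen_complE. Qed.

Lemma of_form_Or f g : of_form (Or f g) = Order.join (of_form f) (of_form g) :> clopen X.
Proof. by apply: clopen_eq => p; rewrite clopen_joinE -sat_Or. Qed.

Lemma over_subalgebra G : subalgebra (clopen_over G).
Proof.
split.
- by exists Bot.
- by exists (Neg Bot).
- move=> _ _ [f fG ->] [g gG ->]; exists (And f g); last by rewrite of_form_And.
  by move=> v; rewrite mem_cat => /orP[/fG|/gG].
- move=> _ _ [f fG ->] [g gG ->]; exists (Or f g); last by rewrite of_form_Or.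
  by move=> v; rewrite /= mem_cat => /orP[/fG|/gG].
- by move=> _ [f fG ->]; exists (Neg f); last by rewrite of_form_Neg.
Qed.

Lemma subalgebra_over (B : set (clopen X)) G : subalgebra B ->
  (forall v, G v -> B (of_form (Var v))) -> clopen_over G `<=` B.
Proof.
move=> [B0 _ BI _ BC] BG _ [f fG ->].
elim: f fG => [|v|f IHf g IHg|f IHf] fG //.
- by apply: BG; rewrite -in_setE; apply: fG; rewrite mem_head.
- rewrite of_form_And; apply: BI; [apply: IHf|apply: IHg] => v vf;
  by apply: fG; rewrite mem_cat vf ?orbT.
- by rewrite of_form_Neg; apply: BC; exact: IHf.
Qed.

(** Reduces subalgebras generated by unions to sets of variables, where [over_relatively_complete]
    applies. *)
Lemma generated_over (K : set (set V)) :
  generated (\bigcup_(B in clopen_over @` K) B) = clopen_over (\bigcup_(G in K) G).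
Proof.
apply/seteqP; split.
  apply: smallest_sub; first exact: over_subalgebra.
  by move=> a [_ [G KG <-]]; apply: over_subset => v Gv; exists G.
apply: subalgebra_over.
  split=> [B [] []|B [] []|x y hx hy B hB|x y hx hy B hB|x hx B hB] //.
  - by have [[_ _ h _ _] _] := hB; apply: h; [exact: hx|exact: hy].
  - by have [[_ _ _ h _] _] := hB; apply: h; [exact: hx|exact: hy].
  - by have [[_ _ _ _ h] _] := hB; apply: h; exact: hx.
move=> v [G KG Gv] B [_]; apply; exists (clopen_over G); [by exists G|exact: over_var].
Qed.

Lemma over_eq_in G a (p q : space_point X) : clopen_over G a ->
  (forall v, G v -> sval p v = sval q v) -> a p = a q.
Proof.
move=> [f fG ->] pq; apply: sat_eq_in => v /fG; rewrite in_setE; exact: pq.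
Qed.

(* The hypothesis says that restriction to [G] is an open map from [X] onto
   its image. *)
Lemma over_relatively_complete G :
  (forall l : seq V, exists2 l' : seq V, {subset l' <= G} &
    forall p q, X p -> X q -> {in l', p =1 q} ->
      exists2 r, X r & (forall v, G v -> r v = p v) /\ {in l, r =1 q}) ->
  relatively_complete (clopen_over G) [set: clopen X].
Proof.
move=> ext; split=> // [|y _]; first exact: over_subalgebra.
have [f ->] := of_formE y; have [l' l'G l'P] := ext (vars f).
(* Universal quantification over the values outside [l']; the formula [g] expressing it names the
   largest element below [y]. *)
pose P p := `[< forall q, X q -> {in l', q =1 p} -> sat q f >].
have [|g gl gP] := @form_of_dependence _ P l'.
  move=> p q pq; apply/asbool_equiv_eq; split=> h r Xr rp; apply: h => // v vl.
    by rewrite rp // pq.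
  by rewrite rp // pq.
exists (of_form g); split; first split.
- by exists g => // v /gl /l'G.
- apply/clopen_leP => -[p Xp] /=; rewrite gP => /asboolP; exact.
- move=> x [xG /clopen_leP xf]; apply/clopen_leP => -[p Xp] xp /=.
  rewrite gP; apply/asboolP => q Xq qp.
  (* The point [r] looks like [p] to [x] and like [q] to [f], so [x <= y] carries over from [p] to
     [q]. *)
  have [|r Xr [rp rq]] := l'P p q Xp Xq; first by move=> v /qp.
  rewrite -(@sat_eq_in _ r q) //.
  by apply: (xf (exist _ r Xr)); rewrite (over_eq_in (q := exist _ p Xp) xG).
Qed.

Lemma countable_over G : countable G -> countable (clopen_over G).
Proof.
move=> /countable_injP[e ei].
have natnat : embeds (nat * nat) nat.
  by exists choice.pickle; exact: pcan_inj choice.pickleK.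
have [c ci] := embeds_form_in (embeds_refl nat) natnat (embeds_refl nat).
have ex a : clopen_over G a -> {f | {subset vars f <= G} /\ a = of_form f}.
  by move=> Ga; apply: cid; have [f fG fa] := Ga; exists f.
pose F a := if pselect (clopen_over G a) is left h then sval (ex a h) else Bot.
have FP a : clopen_over G a -> {subset vars (F a) <= G} /\ a = of_form (F a).
  by rewrite /F; case: pselect => // h _; case: (ex a h).
apply/countable_injP; exists (fun a => c (form_map e (F a))) => a b.
rewrite !in_setE => /FP[aG aE] /FP[bG bE] /ci /(form_map_inj_in ei aG bG) ab.
by rewrite aE bE ab.
Qed.

Lemma countable_over_support (Y : set (clopen X)) : countable Y ->
  exists2 G, countable G & Y `<=` clopen_over G.
Proof.
move=> cY; pose F a := sval (cid (of_formE a)).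
have FP a : a = of_form (F a) by rewrite /F; case: cid.
exists (\bigcup_(a in Y) [set` vars (F a)]).
  apply: bigcup_countable => // a _; apply: finite_set_countable.
  exact: finite_seq.
move=> a Ya; exists (F a) => // v va; rewrite in_setE; by exists a.
Qed.

Lemma embeds_clopen T : embeds nat T -> embeds (T * T) T -> embeds V T ->
  embeds (clopen X) T.
Proof.
move=> natT TT VT; apply: embeds_trans (embeds_form_in natT TT VT).
exists (fun a => sval (cid (of_formE a))) => a b.
by case: cid => f /= ->; case: cid => g /= -> ->.
Qed.

End Over.
Arguments clopen_over {V X} G.

(** * Free tuples *)

Lemma embeds_extend T U (A : set T) : U -> embeds A U ->
  exists f : T -> U, {in A &, injective f}.
Proof.
move=> u0 [f fi].
exists (fun t => if pselect (t \in A) is left h then f (SigSub h) else u0).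
move=> x y xA yA; case: pselect => // xA'; case: pselect => // yA'.
by move=> /fi [].
Qed.

Definition set_at d T (s : 'I_d -> T) (i : 'I_d) (t : T) : 'I_d -> T :=
  fun j => if j == i then t else s j.

Lemma set_at_id d T (s : 'I_d -> T) i t : set_at (set_at s i t) i (s i) = s.
Proof. by apply/funext => j; rewrite /set_at; case: eqP => // ->. Qed.

Lemma set_at_inj d T (s : 'I_d -> T) i : injective (set_at s i).
Proof. by move=> t t' /(congr1 (@^~ i)); rewrite /set_at eqxx. Qed.

(* The coordinates are chosen from the last one down: the choice of the [j]-th
   one has to avoid one countable set for each tuple of the lower coordinates,
   which is at most [aleph j] points in all. *)
Lemma free_tuple d T (t0 : T) (K : nat -> set T)
    (bad : 'I_d -> ('I_d -> T) -> set T) :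
  (forall i, (i < d)%N -> ~ embeds (K i) (aleph i)) ->
  (forall i, (i < d)%N -> embeds (K i) (aleph i.+1)) ->
  (forall i u, countable (bad i u)) ->
  exists s : 'I_d -> T, forall i, ~ bad i (set_at s i t0) (s i).
Proof.
move=> Kbig Ksmall cbad.
(* Coordinates of [s] from [j] on must work for all lower coordinates taken from the sets [K i]. The
   induction goes down from [d] to [0]. *)
suff free j : (j <= d)%N -> exists s : 'I_d -> T, forall r : 'I_d -> T,
    (forall i : 'I_d, (i < j)%N -> K i (r i)) ->
    (forall i : 'I_d, (j <= i)%N -> r i = s i) ->
    forall i : 'I_d, (j <= i)%N -> ~ bad i (set_at r i t0) (r i).
  by have [s sP] := free 0%N (leq0n d); exists s => i; exact: sP.
move=> jd; rewrite -(subKn jd); elim: (d - j)%N (leq_subr j d) => {j jd} [|n IH] nd.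
  by exists (fun=> t0) => r _ _ i; rewrite subn0 leqNgt ltn_ord.
have [s sP] := IH (ltnW nd); set j := (d - n.+1)%N.
have jS : (d - n)%N = j.+1 by rewrite /j subnS prednK // subn_gt0.
have jd : (j < d)%N by rewrite -jS leq_subr.
rewrite jS in sP; pose o := Ordinal jd.
have [a Ka aP] : exists2 a, K j a & forall r : 'I_d -> T,
    (forall i : 'I_d, (i < j)%N -> K i (r i)) ->
    (forall i : 'I_d, (j < i)%N -> r i = s i) -> ~ bad o (set_at r o t0) a.
  (* Otherwise each [x] in [K j] is bad for some tuple [r x]. It is then coded by the lower
     coordinates of [r x] and its index in a countable bad set, so [K j] embeds in [aleph j]. *)
  apply: contrapT => nex; apply: (Kbig _ jd).
  have ex (x : K j) : {r : 'I_d -> T | [/\ forall i : 'I_d, (i < j)%N -> K i (r i),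
      forall i : 'I_d, (j < i)%N -> r i = s i & bad o (set_at r o t0) (val x)]}.
    apply: cid; apply: contrapT => nr; apply: nex; exists (val x).
      exact: set_valP.
    by move=> r h1 h2 h3; apply: nr; exists r.
  pose r x := sval (ex x); pose u x := set_at (r x) o t0.
  have [e0 _] := embeds_nat_aleph j.
  have /choice[k kP] (i : 'I_d) : exists k : T -> aleph j,
      (i < j)%N -> {in K i &, injective k}.
    case: (ltnP i j) => [ij|_]; last by exists (fun=> e0 0%N).
    have [|k ki] := @embeds_extend _ (aleph j) (K i) (e0 0%N); last by exists k.
    by apply: embeds_trans (Ksmall _ (ltn_ord i)) _; exact: aleph_le.
  have /choice[c cP] v : exists c : T -> nat, {in bad o v &, injective c}.
    exact/countable_injP.
  have natA := embeds_nat_aleph j; have AA := aleph_square j.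
  have TA := embeds_tuple_in natA AA d (embeds_refl _).
  apply: embeds_trans (embeds_prod_in AA TA natA).
  exists (fun x : K j => (fun i : 'I_d => if (i < j)%N then k i (r x i) else e0 0%N,
    c (u x) (val x))) => x y [] rxy.
  (* Lower coordinates agree by the code, higher ones are those of [s], and the [j]-th is erased. *)
  have [x1 x2 x3] := svalP (ex x); have [y1 y2 y3] := svalP (ex y).
  have uxy : u x = u y.
    apply/funext => i; rewrite /u /set_at; case: eqP => // io.
    have [ij|ij|ij] := ltngtP i j; last by case: io; exact: val_inj.
      apply: (kP i) => //; rewrite ?in_setE; [exact: x1|exact: y1|].
      by have := congr1 (@^~ i) rxy; rewrite /= ij.
    by rewrite /r x2 // y2.
  rewrite uxy => /(cP (u y)) xy; apply: val_inj; apply: xy.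
    by rewrite in_setE -uxy.
  by rewrite in_setE.
exists (set_at s o a) => r rK rs i ji.
have ro : r o = a by rewrite rs // /set_at eqxx.
have rs' (k : 'I_d) : (j < k)%N -> r k = s k.
  move=> jk; rewrite rs ?(ltnW jk) // /set_at; case: eqP => // ko.
  by rewrite ko ltnn in jk.
move: ji; rewrite leq_eqVlt => /orP[/eqP ji|ji].
  by have -> : i = o; [exact: val_inj|rewrite ro; exact: aP].
apply: sP => // k; rewrite ltnS leq_eqVlt => /orP[/eqP kj|/rK //].
have -> : k = o by exact: val_inj.
by rewrite ro.
Qed.

(** * The algebra presented by tuples and facets *)

(** A generator [inr (i, u, n)] stands for a facet, and occurs in a relation, only when [u i] is the
    erasing value [t0]. *)
Definition gens d T : Type := (('I_d -> T) + 'I_d * ('I_d -> T) * nat)%type.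
HB.instance Definition _ d T := gen_eqMixin (gens d T).
HB.instance Definition _ d T := gen_choiceMixin (gens d T).

Section Algebra.
Context {d : nat} {T : Type} (t0 : T).
Hypothesis d_gt0 : (0 < d)%N.

Local Notation tuples := ('I_d -> T).
Local Notation gens := (gens d T).
Implicit Types (s u : tuples) (v : gens) (I : set T) (p q : gens -> bool).

(* [inl s] is the generator attached to the tuple [s], and [facet i s n] the
   [n]-th generator attached to the tuple [s] with its [i]-th coordinate
   erased, that is, replaced by [t0]. *)
Definition facet (i : 'I_d) s (n : nat) : gens := inr (i, set_at s i t0, n).

(** The points at which all relations hold: the dual space of the presented algebra. *)
Definition facet_space : set (gens -> bool) :=
  [set p | forall s n, (forall i, p (facet i s n)) -> p (inl s)].

Local Notation A := (clopen facet_space).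

Local Notation ev v := (of_form (Var (v : gens)) : A).

Definition coords v : tuples := match v with inl s => s | inr w => w.1.2 end.

Definition gens_over I : set gens := [set v | forall i, I (coords v i)].

Lemma countable_gens_over I : countable I -> countable (gens_over I).
Proof.
move=> /countable_injP[c ci].
pose e s := [seq c (s i) | i <- enum 'I_d].
have ei s s' : (forall i, I (s i)) -> (forall i, I (s' i)) -> e s = e s' -> s = s'.
  move=> Is Is' /eq_in_map ss'; apply/funext => i; apply: ci.
  - by rewrite in_setE.
  - by rewrite in_setE.
  - by apply: ss'; rewrite mem_enum.
pose h v : seq nat + 'I_d * seq nat * nat := match v with
  | inl s => inl (e s) | inr w => inr (w.1.1, e w.1.2, w.2) end.
apply/countable_injP; exists (choice.pickle \o h) => v w.
rewrite !in_setE => Iv Iw /= /(pcan_inj choice.pickleK).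
case: v w Iv Iw => [s|[[i s] n]] [s'|[[i' s'] n']] // Is Is'.
- by move=> [] /(ei s s' Is Is') ->.
- by move=> [] -> /(ei s s' Is Is') -> ->.
Qed.

(** Since [0 < d], the left side of each relation contains a facet, so it is false at [p]. *)
Lemma facet_spaceP p : (forall w, p (inr w) = false) -> facet_space p.
Proof. by move=> p0 s n /(_ (Ordinal d_gt0)); rewrite /facet p0. Qed.

(** Two points with all facets false that differ only at [inl s] cannot be separated without
    [inl s]. *)
Lemma over_inl (H : set gens) s : clopen_over H (ev (inl s)) -> H (inl s).
Proof.
move=> Hs; apply: contrapT => nHs.
pose p b v := if v is inl _ then b || (v != inl s) else false.
have Xp b : facet_space (p b) by exact: facet_spaceP.
have : ev (inl s) (exist _ _ (Xp true)) = ev (inl s) (exist _ _ (Xp false)).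
  apply: (over_eq_in Hs) => -[s'|//] Hs' /=.
  by apply/esym/eqP => e; rewrite e in Hs'.
by rewrite /= eqxx.
Qed.

(** Formulas over the generators code into [T]; conversely, constant tuples give distinct
    elements. *)
Lemma card_clopen n : T = aleph n -> card_aleph n [set: A].
Proof.
move=> TE; apply: card_aleph_aleph; rewrite -TE card_eq_le.
have natT : embeds nat T by rewrite TE; exact: embeds_nat_aleph.
have TT : embeds (T * T) T by rewrite TE; exact: aleph_square.
apply/andP; split; apply/embeds_setT.
  have tT : embeds tuples T by apply: embeds_tuple_in (embeds_refl _).
  apply: embeds_clopen => //; apply: embeds_sum_in => //.
  apply: embeds_prod_in => //; apply: embeds_prod_in => //.
  by apply: embeds_trans natT; exists val; exact: val_inj.
exists (fun t => ev (inl (fun=> t))) => t t' tt'.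
have : clopen_over [set inl (fun=> t) : gens] (ev (inl (fun=> t'))).
  by rewrite -tt'; exact: over_var.
by move=> /over_inl [] /(congr1 (@^~ (Ordinal d_gt0))) ->.
Qed.

(** * The club witnessing the [d]-ary FN *)

(** The condition [I t0] puts the facets of each tuple over [I] into the subalgebra, as erasing
    writes [t0]. *)
Definition closed_subalgebras : set (set A) :=
  [set B | exists I, [/\ countable I, I t0 & B = clopen_over (gens_over I)]].

(** Recovers [I] from the subalgebra through constant tuples, so no choice of [I] is needed. *)
Definition trace (B : set A) : set T :=
  [set t | B (ev (inl (fun=> t)))].

Lemma trace_over I : trace (clopen_over (gens_over I)) = I.
Proof.
apply/seteqP; split=> t; first by move=> /over_inl /(_ (Ordinal d_gt0)).
by move=> It; apply: over_var.
Qed.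

Lemma closed_subalgebrasE B : closed_subalgebras B ->
  [/\ countable (trace B), trace B t0 & B = clopen_over (gens_over (trace B))].
Proof. by move=> [I [cI It0 ->]]; rewrite trace_over. Qed.

Lemma club_closed_subalgebras : club [set: A] closed_subalgebras.
Proof.
split.
- move=> B [I [cI _ ->]]; split=> //.
  by apply: countable_over; exact: countable_gens_over.
- move=> Y [_ cY]; have [G cG YG] := countable_over_support cY.
  pose I := \bigcup_(b in [set: bool])
    (if b then \bigcup_(v in G) range (coords v) else [set t0]).
  exists (clopen_over (gens_over I)); last first.
    apply: subset_trans YG _; apply: over_subset => v Gv i.
    by exists true => //; exists v => //; exists i.
  exists I; split=> //; last by exists false.
  apply: bigcup_countable => // -[] _; last exact: finite_set_countable.
  by apply: bigcup_countable => // v _; exact: sub_countable (card_image_le _ _) _.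
- move=> K KE cK [B0 KB0] Ktot.
  have Kup B B' : K B -> K B' -> exists C, [/\ K C, B `<=` C & B' `<=` C].
    move=> KB KB'; have [h|h] := Ktot _ _ KB KB'.
      by exists B'; split=> //; exact: subset_refl.
    by exists B; split=> //; exact: subset_refl.
  have KEs B : K B -> subalgebra B.
    by move=> /KE [I [_ _ ->]]; exact: over_subalgebra.
  exists (\bigcup_(B in K) trace B); split.
  + by apply: bigcup_countable => // B /KE /closed_subalgebrasE[].
  + by exists B0 => //; have [] := closed_subalgebrasE (KE _ KB0).
  + apply/seteqP; split.
      move=> a [B KB Ba]; have [_ _ BE] := closed_subalgebrasE (KE _ KB).
      move: Ba; rewrite {1}BE; apply: over_subset => v vB i.
      by exists B.
    apply: subalgebra_over.
      have [h0 h1 _ _ _] := KEs _ KB0.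
      split; [by exists B0|by exists B0| | |].
      * move=> x y [B KB Bx] [B' KB' By]; have [C [KC BC B'C]] := Kup _ _ KB KB'.
        have [_ _ h _ _] := KEs _ KC.
        by exists C => //; apply: h; [exact: BC|exact: B'C].
      * move=> x y [B KB Bx] [B' KB' By]; have [C [KC BC B'C]] := Kup _ _ KB KB'.
        have [_ _ _ h _] := KEs _ KC.
        by exists C => //; apply: h; [exact: BC|exact: B'C].
      * move=> x [B KB Bx]; exists B => //; have [_ _ _ _ h] := KEs _ KB.
        exact: h.
    move=> v vK.
    (* The finitely many coordinates of [v] all lie in the trace of one member of the chain. *)
    have [B KB BP] : exists2 B, K B & forall i, i \in enum 'I_d -> trace B (coords v i).
      elim: (enum 'I_d) => [|i l [B KB BP]]; first by exists B0.
      have [B' KB' B'P] := vK i; have [C [KC BC B'C]] := Kup _ _ KB KB'.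
      exists C => // k; rewrite inE => /orP[/eqP ->|/BP]; first exact: B'C.
      exact: BC.
    exists B => //; have [_ _ ->] := closed_subalgebrasE (KE _ KB).
    by apply: over_var => i; apply: BP; rewrite mem_enum.
Qed.

Lemma closed_subalgebras_rc k (F : set (set A)) :
  (k < d)%N -> F #= `I_k -> F `<=` closed_subalgebras ->
  relatively_complete (generated (\bigcup_(B in F) B)) [set: A].
Proof.
move=> kd Fk FE.
pose g (B : set A) := gens_over (trace B).
have FgE : F = clopen_over @` (g @` F).
  apply/seteqP; split=> [B FB|_ [_ [B FB <-] <-]].
    exists (g B); first by exists B.
    by have [_ _ <-] := closed_subalgebrasE (FE _ FB).
  by have [_ _ <-] := closed_subalgebrasE (FE _ FB).
rewrite FgE generated_over bigcup_image; set G := \bigcup_(B in F) g B.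
have Gfacet s n i : G (inl s) -> G (facet i s n).
  move=> [B FB Bs]; exists B => // j /=; rewrite /set_at; case: eqP => // _.
  by have [] := closed_subalgebrasE (FE _ FB).
have Gclosed s n : (forall i, G (facet i s n)) -> G (inl s).
  move=> Gs; pose f i := sval (cid2 (Gs i)).
  have fF i : F (f i) by rewrite /f; case: cid2.
  have fP i j : j != i -> trace (f i) (s j).
    move=> ji; rewrite /f; case: cid2 => B _ /(_ j) /=.
    by rewrite /set_at (negbTE ji).
  (* If two facets lie in one member, the [i]-th supplies all coordinates but [s i], and the [j]-th
     supplies [s i]. Otherwise [F] has at least [d] members. *)
  have [[i [j [ij fij]]]|inj_f] := pselect (exists i j, i != j /\ f i = f j).
    exists (f i) => // m; have [->|mi] := eqVneq m i; last exact: fP.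
    by rewrite fij; exact: fP.
  suff : (d <= k)%N by rewrite leqNgt kd.
  rewrite -card_le_II -(card_le_eqr Fk) (card_le_eql card_II).
  apply/embeds_card_le; exists (fun i => SigSub (mem_set (fF (val i)))).
  move=> i j /(congr1 val) /= fij; apply: val_inj; apply: contrapT => /eqP ij.
  by apply: inj_f; exists (val i), (val j).
apply: over_relatively_complete => l.
pose ns := pmap (fun v => if v is inr w then Some w.2 else None) l.
pose zs := [seq (i, v) | i <- enum 'I_d, v <- l].
(* Facets of the tuples in [l], at the levels occurring in [l]; on those in [G], [p] and [q] must
   agree. *)
pose fs := [seq facet z.1 (coords z.2) n | z <- zs, n <- ns].
exists [seq v <- l ++ fs | `[< G v >]].
  by move=> v; rewrite mem_filter in_setE => /andP[/asboolP].
move=> p q Xp Xq pq.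
have pqG v : G v -> v \in l ++ fs -> p v = q v.
  by move=> Gv vl; apply: pq; rewrite mem_filter vl andbT; exact/asboolP.
(* Away from [G] and [l], tuples get true and facets false, so only tuples in [G] or [l] can violate
   a relation. *)
pose r v := if `[< G v >] then p v else if v \in l then q v else
  if v is inl _ then true else false.
exists r; last first.
  split=> v; rewrite /r; first by case: asboolP.
  by case: asboolP => [Gv vl|_ ->//]; apply: pqG => //; rewrite mem_cat vl.
move=> s n rs; rewrite /r; case: asboolP => [Gs|nGs].
  by apply: (Xp s n) => i; have := rs i; rewrite /r asboolT //; exact: Gfacet.
case: ifPn => // sl.
(* A facet outside [G] that is true under [r] must be in [l], so its level [n] occurs there. Hence
   [q] too is true at all facets of [s] at level [n]. *)
have [i0 ni0] : exists i, ~ G (facet i s n).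
  apply: contrapT => h; apply/nGs/(Gclosed s n) => i.
  by apply: contrapT => nGi; apply: h; exists i.
have nl : n \in ns.
  have := rs i0; rewrite /r asboolF //; case: ifPn => // il _.
  by rewrite mem_pmap; apply/mapP; exists (facet i0 s n).
apply: (Xq s n) => i; have := rs i; rewrite /r; case: asboolP => [Gi|_].
  rewrite pqG // mem_cat; apply/orP; right.
  apply: (@allpairs_f _ _ _ (fun z n => facet z.1 (coords z.2) n) zs ns (i, inl s) n) => //.
  by apply: allpairs_f => //; rewrite mem_enum.
by case: ifPn.
Qed.

Lemma ary_FN_clopen : ary_FN A d.
Proof.
exists closed_subalgebras; split; first exact: club_closed_subalgebras.
exact: closed_subalgebras_rc.
Qed.

(** * Failure of the [(d+1)]-ary FN *)

Lemma not_relatively_complete (B : set A) s : subalgebra B ->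
  B `<=` clopen_over [set v : gens | v <> inl s] ->
  (forall i n, B (ev (facet i s n))) ->
  ~ relatively_complete B [set: A].
Proof.
move=> [_ B1 BI _ _] Bs Bfacet [_ _ _ /(_ (ev (inl s)) I)].
move=> [m [[Bm /clopen_leP my] mmax]].
have [f fs mE] := Bs _ Bm.
pose ns := pmap (fun v => if v is inr w then Some w.2 else None) (vars f).
(* A level above all those occurring in the formula of [m]. *)
pose n := (\max_(k <- ns) k).+1.
have fn w : inr w \in vars f -> w.2 != n.
  move=> wf; rewrite neq_ltn ltnS leq_bigmax_seq //.
  by rewrite mem_pmap; apply/mapP; exists (inr w).
have [z Bz zP] : exists2 z : A, B z & forall p : space_point facet_space,
    z p = all (fun i => sval p (facet i s n)) (enum 'I_d).
  elim: (enum 'I_d) => [|i l [z Bz zP]]; first by exists (\top)%O.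
  exists (Order.meet (ev (facet i s n)) z); first exact: BI.
  by move=> p; rewrite clopen_meetE zP.
have zm : (z <= m)%O.
  apply: mmax; split=> //; apply/clopen_leP => -[p Xp]; rewrite zP /= => /allP zp.
  by apply: (Xp s n) => i; apply: zp; rewrite mem_enum.
(* The points [p] and [q] agree on [vars f]: facets there are not of level [n], and [inl s] is
   absent. So [m], being above [z], holds at [p] and hence at [q], where [inl s] is false. *)
pose p v := if v is inr w then w.2 == n else true.
have Xp : facet_space p by [].
pose q v := if v is inl _ then v != inl s else false.
have Xq : facet_space q by exact: facet_spaceP.
have mp : m (exist _ p Xp).
  by move/clopen_leP: zm; apply; rewrite zP; apply/allP => i _ /=.
have mq : m (exist _ q Xq).
  move: mp; rewrite mE /= (@sat_eq_in _ p q) // => -[s'|w] vf /=.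
    by apply/esym/eqP => e; have := fs _ vf; rewrite in_setE /= e.
  exact/negbTE/fn.
by have := my _ mq; rewrite /= eqxx.
Qed.

Lemma not_ary_FN_clopen : T = aleph d -> ~ ary_FN A d.+1.
Proof.
move=> TE [E [[EA Ecof _] Erc]].
have exN i u : {B | E B & forall n, B (ev (inr (i, u, n)))}.
  apply: cid2; have [|B EB YB] := Ecof (range (fun n => ev (inr (i, u, n)))).
    by split=> //; exact: card_image_le.
  by exists B => // n; apply: YB; exists n.
pose N i u := s2val (exN i u).
have NE i u : E (N i u) := s2valP (exN i u).
have NP i u n : N i u (ev (inr (i, u, n))) := s2valP' (exN i u) n.
have exS i u : {G | countable G & N i u `<=` clopen_over G}.
  by apply: cid2; apply: countable_over_support; have [] := EA _ (NE i u).
(* Values of the erased coordinate whose tuple occurs in the support chosen for [N i u]. *)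
pose bad i u := [set t | s2val (exS i u) (inl (set_at u i t))].
have cbad i u : countable (bad i u).
  have /countable_injP[c ci] := s2valP (exS i u).
  apply/countable_injP; exists (fun t => c (inl (set_at u i t))) => t t'.
  rewrite !in_setE => bt bt' ctt'.
  have [] := ci _ _ (mem_set bt) (mem_set bt') ctt'; exact: set_at_inj.
have exh (i : nat) : (i < d)%N -> embeds (aleph i.+1) T.
  by rewrite TE => /aleph_le.
(* A copy of [aleph i.+1] inside [T]; it fits because [i < d]. *)
pose K (i : nat) :=
  if pselect (i < d)%N is left h then range (sval (cid (exh i h))) else set0.
have KE i : (i < d)%N -> embeds (K i) (aleph i.+1) /\ embeds (aleph i.+1) (K i).
  move=> id; rewrite /K; case: pselect => // h; case: cid => f fi /=.
  have := inj_card_eq (A := setT) (f := f) (fun x y _ _ => @fi x y).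
  rewrite card_eq_le => /andP[/embeds_card_le h1 /embeds_card_le h2]; split.
    by apply: embeds_trans h1 _; exists val; exact: val_inj.
  by apply: embeds_trans h2; exists (fun x => SigSub (in_setT x)) => x y [].
have [||s sP] := @free_tuple d T t0 K bad _ _ cbad.
- by move=> i /KE[_ h] /(embeds_trans h); exact: aleph_lt.
- by move=> i /KE[].
pose F := range (fun i => N i (set_at s i t0)).
(* The members [N i (set_at s i t0)] may coincide, so [F] has at most [d] elements. *)
have [k Fk kd] : exists2 k, F #= `I_k & (k < d.+1)%N.
  have Fd : F #<= `I_d by rewrite (card_le_eqr card_II); exact: card_image_le.
  have [k Fk] : finite_set F by apply: finite_image.
  by exists k => //; rewrite ltnS -card_le_II -(card_le_eql Fk).
have FE : F `<=` E by move=> _ [i _ <-].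
have rc := Erc k F kd Fk FE; have [subB _ _ _] := rc.
apply: (@not_relatively_complete _ s subB) rc.
  apply: smallest_sub; first exact: over_subalgebra.
  move=> a [_ [i _ <-]] Na; have Sa := s2valP' (exS i (set_at s i t0)) _ Na.
  (* Restoring the erased coordinate gives back [s], so freeness of [s] keeps [inl s] out of the
     support. *)
  apply: over_subset Sa => v Sv /= vs; apply: (sP i).
  by rewrite /bad /= set_at_id -vs.
move=> i n; apply: sub_gen_smallest; exists (N i (set_at s i t0)); last exact: NP.
by exists i.
Qed.

End Algebra.

Theorem theorem2p17 (d : nat) (d_ge1 : (1 <= d)%N) :
  exists (disp : Order.disp_t) (A : ctbDistrLatticeType disp),
    [/\ card_aleph d [set: A], ary_FN A d & ~ ary_FN A d.+1].
Proof.
have [t _] := embeds_nat_aleph d.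
exists clopen_display, (clopen (@facet_space d _ (t 0%N)) : ctbDistrLatticeType _).
split.
- exact: card_clopen.
- exact: ary_FN_clopen.
- exact: not_ary_FN_clopen.
Qed.
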